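(* Let $R$ be a commutative ring with identity and let $A\in M_{s\times s}(R)$ be such that $AA^t=\mathrm{adiag}(\lambda_1,\dots,\lambda_s)$ for some units $\lambda_1,\dots,\lambda_s\in U(R)$. Suppose that $C_1,\dots,C_s$ are linear codes of the same length over $R$ such that $C_i=C_{s-i+1}^\perp$ for $i=1,\dots,s$. Then the matrix-product code $[C_1\,\dots\,C_s]\,A$ is self-dual.
   Context: $U(R)$ is the group of units of $R$; $M_{s\times s}(R)$ is the set of $s\times s$ matrices over $R$; $A^t$ is the transpose of $A$; $\mathrm{adiag}(\lambda_1,\dots,\lambda_s)$ is the $s\times s$ anti-diagonal matrix whose entry in position $(i,s-i+1)$ is $\lambda_i$ (all other entries $0$). A linear code of length $m$ over $R$ is an $R$-submodule of $R^m$. With $\langle x,y\rangle=\sum_{k} x_ky_k$, the dual of a linear code $C\subseteq R^m$ is $C^\perp=\{x\in R^m : \langle x,c\rangle=0 \text{ for all } c\in C\}$; $C$ is self-dual if $C=C^\perp$. For linear codes $C_1,\dots,C_s$ of length $m$ and $A=(a_{i,j})\in M_{s\times s}(R)$, the matrix-product code is $[C_1\,\dots\,C_s]\,A=\{(c_1\,\dots\,c_s)A : c_i\in C_i\}$, where $(c_1\,\dots\,c_s)$ is the $m\times s$ matrix whose $i$th column is $c_i$. It is viewed as a linear code of length $ms$ by identifying an $m\times s$ matrix with the concatenation of its columns, so its codewords are $\left(\sum_{i=1}^s a_{i,1}c_i,\dots,\sum_{i=1}^s a_{i,s}c_i\right)$ with $c_i\in C_i$. *)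

(* Defs.v *)
From mathcomp Require Import all_boot all_algebra.
From mathcomp Require Import boolp classical_sets.

Set Implicit Arguments.
Unset Strict Implicit.
Unset Printing Implicit Defensive.

Import GRing.Theory.
Local Open Scope classical_set_scope.
Local Open Scope ring_scope.

(* [GRing.unit] needs a [unitRingType], which excludes the zero ring, so
   being in U(R) is defined directly for an arbitrary commutative ring with identity. *)
Definition is_unit (R : comPzRingType) (x : R) : Prop :=
  exists y : R, x * y = 1.

(* Indices start from 0: the position (i, s-i+1) becomes (i, rev_ord i). *)
Definition adiag_mx (R : comPzRingType) (s : nat) (lambda : 'I_s -> R) :
    'M[R]_s :=
  \matrix_(i, j) if j == rev_ord i then lambda i else 0.

(* A code of length m is a subset of R^m, with words as row vectors. Over an
   arbitrary ring membership is not decidable, hence [set] and not [pred]. *)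
Definition linear_code (R : comPzRingType) (m : nat) (C : set 'rV[R]_m) : Prop :=
  submod_closed [in C].

Definition dotp (R : comPzRingType) (m : nat) (x y : 'rV[R]_m) : R :=
  \sum_(k < m) x 0 k * y 0 k.

Definition dual_code (R : comPzRingType) (m : nat) (C : set 'rV[R]_m) :
    set 'rV[R]_m :=
  [set x | forall c, C c -> dotp x c = 0].

Definition self_dual (R : comPzRingType) (m : nat) (C : set 'rV[R]_m) : Prop :=
  C = dual_code C.

Definition cols_mx (R : comPzRingType) (m s : nat) (c : 'I_s -> 'rV[R]_m) :
    'M[R]_(m, s) :=
  \matrix_(k, i) c i 0 k.

(* [mxvec] concatenates rows; transposing first concatenates columns. *)
Definition matrix_product_code (R : comPzRingType) (m s : nat)
    (C : 'I_s -> set 'rV[R]_m) (A : 'M[R]_s) : set 'rV[R]_(s * m) :=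
  [set mxvec (cols_mx c *m A)^T | c in [set c | forall i, C i (c i)]].

(* Main.v *)
(** The inner product of the codewords of [c] and [d] is the trace of
    [c A A^T d^T], that is [\sum_i lambda_i <c_i, d_(s-i+1)>]; duality of the
    [C_i] makes it vanish.  Conversely [A] is invertible because [A A^T] is, so
    every word of the ambient space comes from some [c], and testing it against
    the [d] supported on a single index shows that each [c_i] lies in
    [C_(s-i+1)^\perp = C_i]. *)
Require Import Defs.
From mathcomp Require Import all_boot all_algebra.
From mathcomp Require Import boolp classical_sets.
Local Open Scope classical_set_scope.
Local Open Scope ring_scope.
Import GRing.Theory.

Lemma dotp_mxvec (R : comPzRingType) (s m : nat) (X Y : 'M[R]_(s, m)) :
  dotp (mxvec X) (mxvec Y) = \sum_i \sum_k X i k * Y i k.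
Proof.
rewrite /dotp (reindex _ (curry_mxvec_bij s m)) pair_bigA /=.
by apply: eq_bigr => -[i k] _ /=; rewrite !mxvecE.
Qed.

Lemma dotp0r (R : comPzRingType) (m : nat) (x : 'rV[R]_m) : dotp x 0 = 0.
Proof. by apply: big1 => k _; rewrite mxE mulr0. Qed.

Lemma dotp_mxvec_mul (R : comPzRingType) (s m : nat) (A : 'M[R]_s)
    (lambda : 'I_s -> R) (c d : 'I_s -> 'rV[R]_m) :
  A *m A^T = adiag_mx lambda ->
  dotp (mxvec (cols_mx c *m A)^T) (mxvec (cols_mx d *m A)^T) =
    \sum_i lambda i * dotp (c i) (d (rev_ord i)).
Proof.
move=> AAt; rewrite dotp_mxvec exchange_big /=.
transitivity (\tr (cols_mx c *m adiag_mx lambda *m (cols_mx d)^T)).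
  rewrite -AAt mulmxA -mulmxA -trmx_mul; apply: eq_bigr => k _.
  by rewrite [RHS]mxE; apply: eq_bigr => i _; rewrite !(mxE trmx_key).
(* Cyclicity of the trace trades the sum over the [m] coordinates for one over the [s] code
   indices. *)
rewrite -mulmxA mxtrace_mulC; apply: eq_bigr => i _.
rewrite -mulmxA !mxE (bigD1 (rev_ord i)) //= big1 => [|j /negPf jN].
  rewrite !mxE eqxx addr0; congr (_ * _).
  by apply: eq_bigr => k _; rewrite !mxE mulrC.
by rewrite !mxE jN mul0r.
Qed.

Lemma adiag_mx_rinv (R : comPzRingType) (s : nat) (lambda : 'I_s -> R) :
  (forall i, is_unit (lambda i)) ->
  exists K : 'M[R]_s, adiag_mx lambda *m K = 1%:M.
Proof.
(* Transposing puts [mu i] at position [(rev_ord i, i)], where it meets the only nonzero entry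
   [lambda i] of row [i]. *)
move=> /choice[mu lambda_mu]; exists (adiag_mx mu)^T.
apply/matrixP => i j; rewrite !mxE (bigD1 (rev_ord i)) //= big1.
  rewrite !mxE eqxx addr0 (inj_eq rev_ord_inj); case: eqP => [<-|_].
    by rewrite lambda_mu.
  by rewrite mulr0.
by move=> k /negPf kN; rewrite !mxE kN mul0r.
Qed.

Theorem theorem3p5 (R : comPzRingType) (s m : nat) (A : 'M[R]_s)
    (lambda : 'I_s -> R) (C : 'I_s -> set 'rV[R]_m)
    (lambda_unit : forall i, is_unit (lambda i))
    (AAt : A *m A^T = adiag_mx lambda)
    (C_linear : forall i, linear_code (C i))
    (C_dual : forall i, C i = dual_code (C (rev_ord i))) :
  self_dual (matrix_product_code C A).
Proof.
apply/seteqP; split=> [_ [c Cc <-] _ [d Cd <-]|w w_dual].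
  rewrite (dotp_mxvec_mul _ _ _ _ _ _ _ AAt); apply: big1 => i _.
  by have := Cc i; rewrite C_dual => -> //; rewrite mulr0.
have [K JK] := adiag_mx_rinv _ _ _ lambda_unit.
(* Over a commutative ring, the right inverse [A^T *m K] of the square matrix [A] is also a left
   inverse. *)
have AinvA : A^T *m K *m A = 1%:M by apply: mulmx1C; rewrite mulmxA AAt.
(* [M] solves [M *m A = (vec_mx w)^T]; its columns are the words [c i]. *)
pose M := (vec_mx w)^T *m (A^T *m K).
pose c i := (col i M)^T.
have cols_c : cols_mx c = M by apply/matrixP => k i; rewrite !mxE.
have w_c : mxvec (cols_mx c *m A)^T = w.
  by rewrite cols_c -mulmxA AinvA mulmx1 trmxK vec_mxK.
exists c => // i; rewrite C_dual => x Cx.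
pose d j := if j == rev_ord i then x else 0.
(* Away from [rev_ord i] this is where linearity enters: each code contains 0. *)
have Cd j : C j (d j).
  rewrite /d; case: eqP => [-> //|_].
  by have [] := C_linear j; rewrite inE.
have := w_dual _ (imageP _ Cd).
rewrite -w_c (dotp_mxvec_mul _ _ _ _ _ _ _ AAt) (bigD1 i) //= big1 => [|j jNi].
  (* Only [lambda i * dotp (c i) x = 0] is left, and the unit [lambda i] cancels. *)
  rewrite /d eqxx addr0; have [mu lambda_mu] := lambda_unit i.
  by move=> /(congr1 ( *%R mu)); rewrite mulr0 mulrA [mu * _]mulrC lambda_mu mul1r.
by rewrite /d (inj_eq rev_ord_inj) (negPf jNi) dotp0r mulr0.
Qed.
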